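(* Let $E_5(b): Y^2+(1+b)XY+bY=X^3+bX^2$ be the Tate normal form, on which $(0,0)$ is a point of order $5$. Let $\zeta=\zeta_5$ be a primitive $5$-th root of unity, $\alpha=\pm\sqrt{5}=\zeta-\zeta^2-\zeta^3+\zeta^4$, $\varepsilon=\frac{-1+\alpha}{2}$, $\bar\varepsilon=\frac{-1-\alpha}{2}$, and let $u$ be a parameter with $$b=\frac{\varepsilon^5u^5+\bar\varepsilon^5}{u^5+1}.$$ Then the $X$-coordinates of the points of order $5$ in $E_5(b)[5]-\langle(0,0)\rangle$ are given by $$X=-\varepsilon^4\frac{[u-(1+\zeta)^2][u-\zeta(1+\zeta)^2][u-\zeta^2(1+\zeta)^2][u-\zeta^3(1+\zeta)^2]}{(u+\zeta^2)(u+\zeta^3)(u+1)^2},$$ and the corresponding $Y$-coordinates are $$Y_1=\varepsilon^7\frac{[u-(1+\zeta)^2]^2[u-\zeta(1+\zeta)^2]^2[u-\zeta^2(1+\zeta)^2]^2[u-\zeta^3(1+\zeta)^2]}{(u+\zeta^2)^2(u+\zeta^3)(u+\zeta^4)(u+1)^3},$$ $$Y_2=\varepsilon^7\frac{[u-(1+\zeta)^2][u-\zeta(1+\zeta)^2]^2[u-\zeta^2(1+\zeta)^2]^2[u-\zeta^3(1+\zeta)^2]^2}{(u+\zeta)(u+\zeta^2)(u+\zeta^3)^2(u+1)^3}.$$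
   Context: The formulas are derived by computations over an extension of $\mathbb{Q}(\zeta,b)$ but are valid over any field of characteristic different from $5$. Replacing $u$ by $\zeta^i u$ (with $\alpha$ fixed), or $\alpha$ by $-\alpha$ and $u$ by $1/(\zeta^i u)$, gives the other points. *)

(* Defs.v *)
From mathcomp Require Import all_boot all_order all_algebra.
From mathcomp Require Import ring.

Set Implicit Arguments.
Unset Strict Implicit.
Unset Printing Implicit Defensive.

Import GRing.Theory.
Local Open Scope ring_scope.

Section Weierstrass.
Variable K : fieldType.

(* Y^2 + a1 XY + a3 Y = X^3 + a2 X^2 + a4 X + a6 *)
Record weierstrass := Weierstrass { a1 : K; a2 : K; a3 : K; a4 : K; a6 : K }.

Inductive point := Infinity | Affine (x y : K).

Variable E : weierstrass.

Definition disc : K :=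
  let b2 := a1 E ^+ 2 + 4%:R * a2 E in
  let b4 := 2%:R * a4 E + a1 E * a3 E in
  let b6 := a3 E ^+ 2 + 4%:R * a6 E in
  let b8 := a1 E ^+ 2 * a6 E + 4%:R * a2 E * a6 E - a1 E * a3 E * a4 E
            + a2 E * a3 E ^+ 2 - a4 E ^+ 2 in
  - b2 ^+ 2 * b8 - 8%:R * b4 ^+ 3 - 27%:R * b6 ^+ 2 + 9%:R * b2 * b4 * b6.

Definition on_curve (P : point) : Prop :=
  if P is Affine x y then
    y ^+ 2 + a1 E * x * y + a3 E * y = x ^+ 3 + a2 E * x ^+ 2 + a4 E * x + a6 E
  else True.

Definition point_opp (P : point) : point :=
  if P is Affine x y then Affine x (- y - a1 E * x - a3 E) else Infinity.

(* The chord-tangent law.  Only its values at points satisfying [on_curve]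
   are meaningful. *)
Definition point_add (P Q : point) : point :=
  match P, Q with
  | Infinity, _ => Q
  | _, Infinity => P
  | Affine x1 y1, Affine x2 y2 =>
    let third l :=
      let x3 := l ^+ 2 + a1 E * l - a2 E - x1 - x2 in
      Affine x3 (- (l + a1 E) * x3 - (y1 - l * x1) - a3 E) in
    if x1 != x2 then third ((y2 - y1) / (x2 - x1))
    else if y1 + y2 + a1 E * x2 + a3 E == 0 then Infinity
    else third ((3%:R * x1 ^+ 2 + 2%:R * a2 E * x1 + a4 E - a1 E * y1)
                / (2%:R * y1 + a1 E * x1 + a3 E))
  end.

Definition point_muln (n : nat) (P : point) : point :=
  iter n (point_add P) Infinity.

Definition point_mulz (m : int) (P : point) : point :=
  match m with
  | Posz n => point_muln n P
  | Negz n => point_opp (point_muln n.+1 P)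
  end.

Definition has_order (n : nat) (P : point) : Prop :=
  [/\ (0 < n)%N, point_muln n P = Infinity &
      forall m, (0 < m < n)%N -> point_muln m P <> Infinity].

Definition in_cyclic (P Q : point) : Prop := exists m : int, Q = point_mulz m P.

End Weierstrass.

Arguments Infinity {K}.

Section TateNormalForm.
Variable K : fieldType.
Implicit Types z u b : K.

Definition E5 b : weierstrass K := Weierstrass (1 + b) b b 0 0.

Definition alpha z : K := z - z ^+ 2 - z ^+ 3 + z ^+ 4.

(* (-1 + alpha)/2 and (-1 - alpha)/2, written in Z[zeta] so that they keep
   their meaning in characteristic 2; see [epsE] and [epsbarE]. *)
Definition eps z : K := z + z ^+ 4.
Definition epsbar z : K := z ^+ 2 + z ^+ 3.

Definition torsX z u : K :=
  - eps z ^+ 4 *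
  (((u - (1 + z) ^+ 2) * (u - z * (1 + z) ^+ 2) *
    (u - z ^+ 2 * (1 + z) ^+ 2) * (u - z ^+ 3 * (1 + z) ^+ 2)) /
   ((u + z ^+ 2) * (u + z ^+ 3) * (u + 1) ^+ 2)).

Definition torsY1 z u : K :=
  eps z ^+ 7 *
  (((u - (1 + z) ^+ 2) ^+ 2 * (u - z * (1 + z) ^+ 2) ^+ 2 *
    (u - z ^+ 2 * (1 + z) ^+ 2) ^+ 2 * (u - z ^+ 3 * (1 + z) ^+ 2)) /
   ((u + z ^+ 2) ^+ 2 * (u + z ^+ 3) * (u + z ^+ 4) * (u + 1) ^+ 3)).

Definition torsY2 z u : K :=
  eps z ^+ 7 *
  (((u - (1 + z) ^+ 2) * (u - z * (1 + z) ^+ 2) ^+ 2 *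
    (u - z ^+ 2 * (1 + z) ^+ 2) ^+ 2 * (u - z ^+ 3 * (1 + z) ^+ 2) ^+ 2) /
   ((u + z) * (u + z ^+ 2) * (u + z ^+ 3) ^+ 2 * (u + 1) ^+ 3)).

Definition given_by z u (P : point K) : Prop :=
  P = Affine (torsX z u) (torsY1 z u) \/ P = Affine (torsX z u) (torsY2 z u).

Lemma sum_prim5 z : 5.-primitive_root z ->
  1 + z + z ^+ 2 + z ^+ 3 + z ^+ 4 = 0.
Proof.
move=> hz; have z1 : z - 1 != 0.
  rewrite subr_eq0; apply/eqP => z1.
  by have := prim_order_dvd hz 1; rewrite z1 expr1n eqxx.
apply: (mulfI z1); rewrite mulr0.
have -> : (z - 1) * (1 + z + z ^+ 2 + z ^+ 3 + z ^+ 4) = z ^+ 5 - 1 by ring.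
by rewrite (prim_expr_order hz) subrr.
Qed.

Lemma alpha_sqr z : 5.-primitive_root z -> alpha z ^+ 2 = 5%:R.
Proof.
move=> hz; apply/eqP; rewrite -subr_eq0; apply/eqP.
have -> : alpha z ^+ 2 - 5%:R =
  (1 + z + z ^+ 2 + z ^+ 3 + z ^+ 4) *
  (z ^+ 4 - 3%:R * z ^+ 3 + z ^+ 2 + 5%:R * z - 5%:R) by rewrite /alpha; ring.
by rewrite sum_prim5 ?mul0r.
Qed.

Lemma epsE z : 5.-primitive_root z -> 2%:R != 0 :> K ->
  eps z = (-1 + alpha z) / 2%:R.
Proof.
move=> hz n2; apply: (mulIf n2); rewrite divfK //; apply/eqP.
rewrite -subr_eq0 -(sum_prim5 hz) /eps /alpha; apply/eqP; ring.
Qed.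

Lemma epsbarE z : 5.-primitive_root z -> 2%:R != 0 :> K ->
  epsbar z = (-1 - alpha z) / 2%:R.
Proof.
move=> hz n2; apply: (mulIf n2); rewrite divfK //; apply/eqP.
rewrite -subr_eq0 -(sum_prim5 hz) /epsbar /alpha; apply/eqP; ring.
Qed.

(* Replacing alpha by - alpha is the automorphism zeta |-> zeta^2 of Q(zeta);
   it must also act on the factors (1 + zeta)^2 = zeta * epsbar^2. *)
Lemma alpha_conj z : 5.-primitive_root z -> alpha (z ^+ 2) = - alpha z.
Proof.
move=> hz; have h6 : z ^+ 6 = z by rewrite exprS (prim_expr_order hz) mulr1.
have h8 : z ^+ 8 = z ^+ 3 by rewrite (exprD z 5 3) (prim_expr_order hz) mul1r.
rewrite /alpha -!exprM h6 h8; ring.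
Qed.

End TateNormalForm.

(* Main.v *)
(** Write T = (0,0), let P(z,u) be the point (torsX z u, torsY1 z u), and note
    that u |-> b is invariant under (z,u) |-> (z, z^i u) and
    (z,u) |-> (z^2, 1/u).  The tangent at P(z,u) has an explicit slope and shows
    2 P(z,u) = P(z^2, 1/u); iterating, 4 P(z,u) = P(z^4, u) = - P(z,u), so that
    P(z,u) has order 5.  Conversely the abscissa of a point of order 5 is a
    root of the division polynomial psi5, of degree 12 with leading
    coefficient 5.  The twelve values 0, -b (the abscissae of the multiples
    of T), torsX(z, z^i u) and torsX(z^2, 1/(z^i u)) are roots of it, and they
    are distinct because every difference factors into cusps of X(5), i.e.
    into powers of u, of the zeros of b and of the poles of b. *)

Require Import Defs.
From mathcomp Require Import all_boot all_order all_algebra.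
From mathcomp Require Import ring.

Set Implicit Arguments.
Unset Strict Implicit.
Unset Printing Implicit Defensive.

Import GRing.Theory.
Local Open Scope ring_scope.

(** * The chord-tangent law with explicit slopes *)

Section GroupLaw.
Variables (K : fieldType) (E : weierstrass K).
Implicit Types (x y l : K) (P Q R : point K).

Definition third_x l x1 x2 : K := l ^+ 2 + a1 E * l - a2 E - x1 - x2.

Definition line_y l x1 y1 x : K := y1 + l * (x - x1).

(** The slope is a free argument, so chords and tangents share one formula and no division occurs in
    it. *)
Definition third l x1 y1 x2 : point K :=
  point_opp E (Affine (third_x l x1 x2) (line_y l x1 y1 (third_x l x1 x2))).

Definition tangent_den x y : K := 2%:R * y + a1 E * x + a3 E.

Definition tangent_num x y : K :=
  3%:R * x ^+ 2 + 2%:R * a2 E * x + a4 E - a1 E * y.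

Lemma point_oppK P : point_opp E (point_opp E P) = P.
Proof. by case: P => [|x y] //=; congr Affine; ring. Qed.

Lemma add_infinityr P : point_add E P Infinity = P.
Proof. by case: P. Qed.

Lemma add_opp x y :
  point_add E (Affine x y) (point_opp E (Affine x y)) = Infinity.
Proof.
rewrite /= eqxx /=; case: ifP => // /eqP[]; ring.
Qed.

Lemma add_eq_infinity x y Q :
  point_add E (Affine x y) Q = Infinity -> Q = point_opp E (Affine x y).
Proof.
case: Q => [|x2 y2] //=; case: ifPn => //; rewrite negbK => /eqP <-.
case: ifP => // /eqP h _; congr Affine.
by apply/eqP; rewrite -subr_eq0 -h; apply/eqP; ring.
Qed.

Lemma add_line l x1 y1 x2 : x1 != x2 ->
  point_add E (Affine x1 y1) (Affine x2 (line_y l x1 y1 x2)) = third l x1 y1 x2.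
Proof.
move=> ne; rewrite /= ne /line_y.
have -> : (y1 + l * (x2 - x1) - y1) / (x2 - x1) = l.
  by field; rewrite subr_eq0 eq_sym.
rewrite /third /= /third_x /line_y; congr Affine; ring.
Qed.

(** A chord is the same line whichever of its two points serves as base, so [add_line] applies from
    both ends. *)
Lemma addC_affine x1 y1 x2 y2 : x1 != x2 ->
  point_add E (Affine x1 y1) (Affine x2 y2) =
  point_add E (Affine x2 y2) (Affine x1 y1).
Proof.
move=> ne; have ne' : x2 - x1 != 0 by rewrite subr_eq0 eq_sym.
have [l ->] : exists l, y2 = line_y l x1 y1 x2.
  by exists ((y2 - y1) / (x2 - x1)); rewrite /line_y divfK // addrC subrK.
rewrite add_line //.
have ne2 : x2 != x1 by rewrite eq_sym.
have := add_line l (line_y l x1 y1 x2) ne2.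
rewrite (_ : line_y l x2 (line_y l x1 y1 x2) x1 = y1); last first.
  by rewrite /line_y; ring.
by move=> ->; rewrite /third /= /third_x /line_y; congr Affine; ring.
Qed.

Lemma add_double l x y : tangent_den x y != 0 ->
  tangent_num x y = l * tangent_den x y ->
  point_add E (Affine x y) (Affine x y) = third l x y x.
Proof.
rewrite /tangent_num /tangent_den => d0 hl; rewrite /= eqxx /=.
rewrite (_ : y + y + _ + _ = 2%:R * y + a1 E * x + a3 E); last by ring.
rewrite (negPf d0) hl mulfK // /third /= /third_x /line_y; congr Affine; ring.
Qed.

(* The line through [P] and [-R] is the line through [P] and [Q]. *)
Lemma third_rot l x1 y1 x2 x3 y3 : x1 != x3 ->
  third l x1 y1 x2 = Affine x3 y3 ->
  point_add E (Affine x1 y1) (point_opp E (Affine x3 y3)) =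
  point_opp E (Affine x2 (line_y l x1 y1 x2)).
Proof.
move=> ne h; have hx : third_x l x1 x2 = x3 by case: h.
rewrite -h /third point_oppK hx add_line // /third.
by rewrite (_ : third_x l x1 x3 = x2) // -hx /third_x; ring.
Qed.

(** Multiples are nested sums, so a vanishing mP restarts the sequence: 5P = P when m is 2 or 4,
    while m = 3 gives 2P = 5P = [Infinity] and then 3P = P. *)
Lemma muln5_infinity P : P <> Infinity -> point_muln E 5 P = Infinity ->
  has_order E 5 P.
Proof.
move=> P0; rewrite /has_order /point_muln /iter add_infinityr => P5.
split=> // -[|[|[|[|[|m]]]]] // _; rewrite ?add_infinityr // => Pm; apply: P0.
- by move: P5; rewrite Pm add_infinityr Pm add_infinityr.
- by move: P5 Pm => /[swap] Pm; rewrite Pm add_infinityr => P2;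
    rewrite P2 add_infinityr in Pm.
- by move: P5; rewrite Pm add_infinityr.
Qed.

(** With S = 2P and 2S = -P, rotating the two tangent lines by [third_rot] gives S + P = -S and P -
    S = -P; hence 3P = -S, 4P = -P and 5P = [Infinity]. *)
Lemma has_order5_double l k x y xS yS :
    tangent_den x y != 0 -> tangent_num x y = l * tangent_den x y ->
    tangent_den xS yS != 0 -> tangent_num xS yS = k * tangent_den xS yS ->
    x != xS ->
    third l x y x = Affine xS yS ->
    third k xS yS xS = point_opp E (Affine x y) ->
  has_order E 5 (Affine x y).
Proof.
move=> d0 hl dS hk ne eS eP; apply: muln5_infinity => //.
have line0 j x0 y0 : line_y j x0 y0 x0 = y0.
  by rewrite /line_y subrr mulr0 addr0.
have PmS := third_rot ne eS; rewrite line0 in PmS.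
have SP : point_add E (Affine xS yS) (Affine x y) = point_opp E (Affine xS yS).
  have ne' : xS != x by rewrite eq_sym.
  by have := third_rot ne' eP; rewrite line0 => <-;
    rewrite -[in LHS](point_oppK (Affine x y)).
rewrite /point_muln /iter add_infinityr (add_double d0 hl) eS addC_affine //.
by rewrite SP PmS add_opp.
Qed.

(** * The 5-division polynomial *)

Definition b2 : K := a1 E ^+ 2 + 4%:R * a2 E.
Definition b4 : K := 2%:R * a4 E + a1 E * a3 E.
Definition b6 : K := a3 E ^+ 2 + 4%:R * a6 E.
Definition b8 : K :=
  a1 E ^+ 2 * a6 E + 4%:R * a2 E * a6 E - a1 E * a3 E * a4 E
  + a2 E * a3 E ^+ 2 - a4 E ^+ 2.

Definition psi2sq x : K :=
  4%:R * x ^+ 3 + b2 * x ^+ 2 + 2%:R * b4 * x + b6.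
Definition psi3 x : K :=
  3%:R * x ^+ 4 + b2 * x ^+ 3 + 3%:R * b4 * x ^+ 2 + 3%:R * b6 * x + b8.
(** This is psi4 psi2^3 - psi3^3, with psi4 / psi2 in the form psi3 (6 x^2 + b2 x + b4) - psi2^4;
    only even powers of psi2 remain, so y disappears. *)
Definition psi5 x : K :=
  psi2sq x ^+ 2 * psi3 x * (6%:R * x ^+ 2 + b2 * x + b4)
  - psi2sq x ^+ 4 - psi3 x ^+ 3.

(* With [l], [l2], [l3] the slopes of the lines joining P to P, 2P and 3P,
   put m = l2 - l, w = l2 + l + a1 and A = x(P) - x(2P).  The tangent
   through P gives w A = psi2, and 4P = -P says that the third line is
   tangent at P, i.e. m w + A = 0; clearing denominators yields psi5. *)
Lemma psi5_root x y : on_curve E (Affine x y) ->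
  point_muln E 5 (Affine x y) = Infinity -> psi5 x = 0.
Proof.
move=> hf h5; set P := Affine x y in h5.
have [d0|d0] := eqVneq (tangent_den x y) 0.
  have e2 : point_add E P P = Infinity.
    rewrite /= eqxx /=.
    have -> : y + y + a1 E * x + a3 E = tangent_den x y.
      by rewrite /tangent_den; ring.
    by rewrite d0 eqxx.
  by move: h5; rewrite /point_muln /iter add_infinityr e2 add_infinityr e2.
have vertical l x2 : third_x l x x2 = x ->
    point_add E P (third l x y x2) = Infinity.
  by rewrite /third => ->; rewrite /line_y subrr mulr0 addr0 add_opp.
have [l hl] : exists l, tangent_num x y = l * tangent_den x y.
  by exists (tangent_num x y / tangent_den x y); rewrite divfK.
have e2 := add_double d0 hl.
move: h5; rewrite /point_muln /iter add_infinityr e2.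
(* If x(2P) = x(P), then 2P = -P, so 3P = [Infinity] and 5P = 2P is affine. Likewise x(3P) = x(P)
   would give 5P = P. *)
have [xSx|xSx] := eqVneq (third_x l x x) x.
  by rewrite vertical // add_infinityr e2.
have [S eS] : exists yS, third l x y x = Affine (third_x l x x) yS.
  by rewrite /third /=; eexists.
move: eS; set xS := third_x l x x in xSx * => eS.
have hS : S = - (line_y l x y xS) - a1 E * xS - a3 E by case: eS.
have join x2 y2 : x2 != x -> exists2 j, y2 = line_y j x y x2 &
    point_add E P (Affine x2 y2) = third j x y x2.
  move=> ne; have ne' : x2 - x != 0 by rewrite subr_eq0.
  exists ((y2 - y) / (x2 - x)); first by rewrite /line_y divfK // addrC subrK.
  rewrite -add_line 1?eq_sym // /P; congr (point_add _ _ (Affine _ _)).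
  by rewrite /line_y divfK // addrC subrK.
rewrite eS; have [l2 h2 ->] := join xS S xSx.
have [xRx|xRx] := eqVneq (third_x l2 x xS) x.
  by rewrite vertical // add_infinityr.
have [R eR] : exists yR, third l2 x y xS = Affine (third_x l2 x xS) yR.
  by rewrite /third /=; eexists.
move: eR; set xR := third_x l2 x xS in xRx * => eR.
have hR : R = - (line_y l2 x y xR) - a1 E * xR - a3 E by case: eR.
rewrite eR; have [l3 h3 ->] := join xR R xRx.
move=> /add_eq_infinity [h4 _].
pose w := l2 + l + a1 E; pose m := l2 - l; pose A := x - xS.
pose d := tangent_den x y.
have A0 : A != 0 by rewrite /A subr_eq0 eq_sym.
(* Two expressions for y(2P) are compared: on the chord of slope [l2], and by negating the third
   point of the tangent. [hv] does the same for 3P. *)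
have hw : w * A = d.
  transitivity (d - (line_y l2 x y xS -
      (- line_y l x y xS - a1 E * xS - a3 E))).
    by rewrite /w /A /d /tangent_den /line_y; ring.
  by rewrite -h2 hS subrr subr0.
have hv : (l3 + l2 + a1 E) * (x - xR) = d.
  transitivity (d - (line_y l3 x y xR -
      (- line_y l2 x y xR - a1 E * xR - a3 E))).
    by rewrite /d /tangent_den /line_y; ring.
  by rewrite -h3 hR subrr subr0.
have hR' : xR = x + m * w by rewrite /xR /third_x /m /w /xS /third_x; ring.
have hA : A = 3%:R * x + a2 E - l ^+ 2 - a1 E * l.
  by rewrite /A /xS /third_x; ring.
have w0 : w != 0 by apply: contra_neq d0 => w0; rewrite -/d -hw w0 mul0r.
have vm : (l3 + l2 + a1 E) * m = - A.
  by apply: (mulfI w0); rewrite mulrN hw -hv hR'; ring.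
(* Put v = l3 + l2 + a1, so v m = -A. Then m w + A equals both -(l3 - l) m and (l3 - l)(l3 + l +
   a1); since m - v = -(l3 + l + a1), the two forms cancel in A (m w + A). *)
have mwA : m * w + A = 0.
  apply: (mulfI A0); rewrite mulr0.
  have hl3 : (l3 - l) * (l3 + l + a1 E) = m * w + A.
    apply/eqP; rewrite -subr_eq0 -(subrr x) -{1}h4 hR' hA /third_x; apply/eqP.
    ring.
  have -> : A * (m * w + A) = (A + m ^+ 2) * (m * w - - A)
      - m ^+ 2 * (m * w + A) by ring.
  have hC : m * w + A = - ((l3 - l) * m).
    by rewrite -[A]opprK -vm /w; ring.
  rewrite opprK {1}hC -hl3 -[A]opprK -vm /m; ring.
have d2 : d ^+ 2 = psi2sq x.
  transitivity (4%:R * (y ^+ 2 + a1 E * x * y + a3 E * y)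
      + (a1 E * x + a3 E) ^+ 2).
    by rewrite /d /tangent_den; ring.
  by rewrite hf /psi2sq /b2 /b4 /b6; ring.
(* The duplication formula x(P) - x(2P) = psi3 / psi2^2; the curve equation eliminates y. *)
have d2A : d ^+ 2 * A = psi3 x.
  pose n := 3%:R * x ^+ 2 + 2%:R * a2 E * x + a4 E.
  transitivity (d ^+ 2 * (3%:R * x + a2 E) - n ^+ 2
      - n * a1 E * (a1 E * x + a3 E)
      + a1 E ^+ 2 * (y ^+ 2 + a1 E * x * y + a3 E * y)).
    transitivity (d ^+ 2 * (3%:R * x + a2 E) - (l * d) * (l * d + a1 E * d)).
      by rewrite hA; ring.
    by rewrite -hl /d /tangent_num /tangent_den /n; ring.
  by rewrite hf d2 /psi2sq /psi3 /n /b2 /b4 /b6 /b8; ring.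
(* The right side is formally half the derivative of [psi2sq]. *)
have dA1 : d * (a1 E + 2%:R * l) = 6%:R * x ^+ 2 + b2 * x + b4.
  rewrite mulrDr mulrCA [d * l]mulrC -hl.
  by rewrite /d /tangent_num /tangent_den /b2 /b4; ring.
rewrite /psi5 -d2A -d2 -dA1 -hw.
(* Follows from d = w A and a1 + 2 l = w - m. *)
transitivity (- w ^+ 6 * A ^+ 8 * (m * w + A)); last by rewrite mwA mulr0.
rewrite /m /w; ring.
Qed.
End GroupLaw.

(** * Parameters, and the zeros and poles of [b] *)

Section Cusps.
Variable K : fieldType.
Implicit Types z u b : K.

Lemma zeta4 z : 5.-primitive_root z -> z ^+ 4 = - 1 - z - z ^+ 2 - z ^+ 3.
Proof.
move=> hz; apply/eqP; rewrite -subr_eq0 -(sum_prim5 hz); apply/eqP; ring.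
Qed.

(* On a smooth fibre [b] is neither 0 nor [epsbar z ^+ 5], its value at
   u = 0. *)
Definition admissible z u b : Prop :=
  [/\ 5.-primitive_root z, u != 0, u ^+ 5 + 1 != 0,
      b = (eps z ^+ 5 * u ^+ 5 + epsbar z ^+ 5) / (u ^+ 5 + 1) & b != 0].

(* The zeros and the poles of [b], see [bE]. *)
Definition cuspP z u (i : nat) : K := u - z ^+ i * (1 + z) ^+ 2.
Definition cuspQ z u (i : nat) : K := u + z ^+ i.

Lemma eps_neq0 z : 5.-primitive_root z -> eps z != 0.
Proof.
move=> hz; have h4 := zeta4 hz; apply/eqP => e0.
have /eqP : eps z * epsbar z = -1 by rewrite /eps /epsbar; ring: h4.
by rewrite e0 mul0r eq_sym oppr_eq0 oner_eq0.
Qed.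

Lemma subr1z_neq0 z : 5.-primitive_root z -> 1 - z != 0.
Proof.
move=> hz; rewrite subr_eq0; apply/eqP => z1.
by have := prim_order_dvd hz 1; rewrite -z1 expr1n eqxx.
Qed.

Lemma zeta_neq0 z : 5.-primitive_root z -> z != 0.
Proof.
move=> hz; apply/eqP => z0; have /eqP := prim_expr_order hz.
by rewrite z0 expr0n eq_sym oner_eq0.
Qed.

Lemma zeta_exp5 z i : 5.-primitive_root z -> (z ^+ i) ^+ 5 = 1.
Proof. by move=> hz; rewrite exprAC (prim_expr_order hz) expr1n. Qed.

Lemma admissible_scale z u b i :
  admissible z u b -> admissible z (z ^+ i * u) b.
Proof.
case=> hz u0 u5 -> b0; split=> //; rewrite ?exprMn ?zeta_exp5 ?mul1r //.
by rewrite mulf_neq0 // expf_neq0 // (zeta_neq0 hz).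
Qed.

(** Squaring z exchanges [eps] and [epsbar]; inverting u exchanges the two terms of the numerator
    back. *)
Lemma admissible_conj z u b : admissible z u b -> admissible (z ^+ 2) u^-1 b.
Proof.
case=> hz u0 u5 hb b0; split=> //.
- by rewrite prim_root_exp_coprime.
- by rewrite invr_eq0.
- have -> : u^-1 ^+ 5 + 1 = (u ^+ 5 + 1) / u ^+ 5 by field.
  by rewrite mulf_neq0 ?invr_eq0 ?expf_neq0.
have h4 := zeta4 hz.
rewrite hb /eps /epsbar; field: h4.
by rewrite u0 addrC u5.
Qed.

Lemma cuspQ_neq0 z u b i : admissible z u b -> cuspQ z u i != 0.
Proof.
case=> hz _ u5 _ _; apply: contraNneq u5 => /eqP; rewrite addr_eq0 => /eqP ->.
by rewrite -mulN1r exprMn zeta_exp5 // mulr1 -signr_odd expr1 addNr.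
Qed.

(** Since (1 + z)^2 = z epsbar^2 and eps epsbar = -1, the fifth power of (1 + z)^2 is -(epsbar /
    eps)^5, where the numerator of [b] vanishes. *)
Lemma cuspP_neq0 z u b i : admissible z u b -> cuspP z u i != 0.
Proof.
case=> hz _ _ -> b0; have h4 := zeta4 hz.
apply: contraNneq b0 => /eqP; rewrite subr_eq0 => /eqP ->.
rewrite [X in _ * X + _]exprMn zeta_exp5 // mul1r.
suff -> : eps z ^+ 5 * ((1 + z) ^+ 2) ^+ 5 + epsbar z ^+ 5 = 0 by rewrite mul0r.
by rewrite /eps /epsbar; ring: h4.
Qed.

Lemma torsXE z u : torsX z u =
  - eps z ^+ 4 * ((cuspP z u 0 * cuspP z u 1 * cuspP z u 2 * cuspP z u 3) /
   (cuspQ z u 2 * cuspQ z u 3 * cuspQ z u 0 ^+ 2)).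
Proof. by rewrite /torsX /cuspP /cuspQ expr0 expr1 mul1r. Qed.

Lemma torsY1E z u : torsY1 z u =
  eps z ^+ 7 * ((cuspP z u 0 ^+ 2 * cuspP z u 1 ^+ 2 * cuspP z u 2 ^+ 2 *
    cuspP z u 3) /
   (cuspQ z u 2 ^+ 2 * cuspQ z u 3 * cuspQ z u 4 * cuspQ z u 0 ^+ 3)).
Proof. by rewrite /torsY1 /cuspP /cuspQ expr0 expr1 mul1r. Qed.

Lemma torsY2E z u : torsY2 z u =
  eps z ^+ 7 * ((cuspP z u 0 * cuspP z u 1 ^+ 2 * cuspP z u 2 ^+ 2 *
    cuspP z u 3 ^+ 2) /
   (cuspQ z u 1 * cuspQ z u 2 * cuspQ z u 3 ^+ 2 * cuspQ z u 0 ^+ 3)).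
Proof. by rewrite /torsY2 /cuspP /cuspQ expr0 !expr1 mul1r. Qed.

(** Splits a heavy identity in two: the common factor [c] is extracted with the cusp factors as
    atoms, then the polynomial cofactor [k] is shown to vanish modulo the cyclotomic relation. *)
Lemma eq_of_factor (x y c k : K) : x - y = c * k -> k = 0 -> x = y.
Proof. by move=> h k0; apply/eqP; rewrite -subr_eq0 h k0 mulr0. Qed.

(* The coordinates of P(z^2, 1/u), see [torsX_conj] and [torsY1_conj]. *)
Definition dblX z u : K := - eps z ^+ 4 *
  (cuspP z u 0 * cuspP z u 1 * cuspP z u 2 * cuspP z u 3) /
  (cuspQ z u 0 ^+ 2 * cuspQ z u 1 * cuspQ z u 4).

Definition dblY z u : K := eps z ^+ 7 *
  (cuspP z u 0 ^+ 2 * cuspP z u 1 * cuspP z u 2 ^+ 2 * cuspP z u 3 ^+ 2) /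
  (cuspQ z u 0 ^+ 3 * cuspQ z u 1 ^+ 2 * cuspQ z u 2 * cuspQ z u 4).

(** The linear factor left in the numerator of the tangent slope at P(z,u) beside its two cusp
    factors. *)
Definition slope_factor z u : K :=
  (3%:R - z + 3%:R * z ^+ 2 + z ^+ 3) * u
  - (3%:R + 2%:R * z + z ^+ 2 + 3%:R * z ^+ 3).

Definition slope z u : K := cuspP z u 0 * cuspP z u 1 * slope_factor z u /
  (cuspQ z u 0 * cuspQ z u 2 * cuspQ z u 4).

(** * Coordinate identities at fixed admissible parameters *)

Section Identities.
Variables z u b : K.
Hypothesis adm : admissible z u b.

Let hz : 5.-primitive_root z. Proof. by case: adm. Qed.
Let u0 : u != 0. Proof. by case: adm. Qed.
Let u5 : u ^+ 5 + 1 != 0. Proof. by case: adm. Qed.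
Let h4 := zeta4 hz.
Let q0 : u + 1 != 0. Proof. exact: (cuspQ_neq0 0 adm). Qed.
Let q1 : u + z != 0. Proof. exact: (cuspQ_neq0 1 adm). Qed.
Let q2 : u + z ^+ 2 != 0. Proof. exact: (cuspQ_neq0 2 adm). Qed.
Let q3 : u + z ^+ 3 != 0. Proof. exact: (cuspQ_neq0 3 adm). Qed.
Let q4 : u + z ^+ 4 != 0. Proof. exact: (cuspQ_neq0 4 adm). Qed.

Ltac cusp_neq0 :=
  by rewrite ?(mulf_neq0, invr_neq0, expf_neq0, oppr_eq0, subr1z_neq0 hz,
    zeta_neq0 hz, eps_neq0 hz, u0, cuspP_neq0 _ adm, cuspQ_neq0 _ adm).

Ltac cusp_ring := rewrite /slope_factor /cuspP /cuspQ /eps /epsbar; ring: h4.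

Ltac cusp_field :=
  rewrite /cuspP /cuspQ /eps /epsbar; field: h4;
  rewrite ?u0 ?q0 ?q1 ?q2 ?q3 ?q4 ?u5; try done.

(* Field identities in which [eps], [cuspP] and [cuspQ] are atoms. *)
Ltac atom_field := by field; rewrite ?(cuspQ_neq0 _ adm).

Lemma bE : b = eps z ^+ 5 *
  (cuspP z u 0 * cuspP z u 1 * cuspP z u 2 * cuspP z u 3 * cuspP z u 4) /
  (cuspQ z u 0 * cuspQ z u 1 * cuspQ z u 2 * cuspQ z u 3 *
       cuspQ z u 4).
Proof. by case: adm => _ _ _ -> _; cusp_field. Qed.

Lemma torsX_neq0 : torsX z u != 0.
Proof. by rewrite torsXE; cusp_neq0. Qed.

Lemma torsXDb_neq0 : torsX z u + b != 0.
Proof.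
have -> : torsX z u + b = - eps z ^+ 6 *
    (cuspP z u 0 * cuspP z u 1 ^+ 2 * cuspP z u 2 ^+ 2 * cuspP z u 3) /
    (cuspQ z u 0 ^+ 2 * cuspQ z u 1 * cuspQ z u 2 * cuspQ z u 3 *
       cuspQ z u 4).
  by rewrite bE /torsX; cusp_field.
cusp_neq0.
Qed.

(** By [tangent_den_tors] this difference is the denominator of the tangent slope, so P(z,u) can be
    doubled by [add_double]. *)
Lemma torsY_sub_neq0 : torsY1 z u - torsY2 z u != 0.
Proof.
have -> : torsY1 z u - torsY2 z u =
    z * (1 - z) ^+ 3 * eps z ^+ 5 * u ^+ 2 *
    (cuspP z u 0 * cuspP z u 1 ^+ 2 * cuspP z u 2 ^+ 2 * cuspP z u 3) /
    (cuspQ z u 0 ^+ 3 * cuspQ z u 1 * cuspQ z u 2 ^+ 2 * cuspQ z u 3 ^+ 2 *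
     cuspQ z u 4).
  rewrite torsY1E torsY2E; apply: (@eq_of_factor _ _ (eps z ^+ 5 *
    (cuspP z u 0 * cuspP z u 1 ^+ 2 * cuspP z u 2 ^+ 2 * cuspP z u 3) /
    (cuspQ z u 0 ^+ 3 * cuspQ z u 1 * cuspQ z u 2 ^+ 2 * cuspQ z u 3 ^+ 2 *
     cuspQ z u 4))
    (eps z ^+ 2 * (cuspP z u 0 * cuspQ z u 1 * cuspQ z u 3
                   - cuspP z u 3 * cuspQ z u 2 * cuspQ z u 4)
     - z * (1 - z) ^+ 3 * u ^+ 2)).
    atom_field.
  by cusp_ring.
cusp_neq0.
Qed.

Lemma on_curve_tors : on_curve (E5 b) (Affine (torsX z u) (torsY1 z u)).
Proof.
rewrite bE /= torsXE torsY1E; apply: (@eq_of_factor _ _ (eps z ^+ 11 *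
  (cuspP z u 0 ^+ 3 * cuspP z u 1 ^+ 3 * cuspP z u 2 ^+ 3 * cuspP z u 3 ^+ 2) /
  (cuspQ z u 0 ^+ 6 * cuspQ z u 1 * cuspQ z u 2 ^+ 4 * cuspQ z u 3 ^+ 3 *
   cuspQ z u 4 ^+ 2))
  (eps z ^+ 3 * cuspP z u 0 * cuspP z u 1 * cuspP z u 2 *
     cuspQ z u 1 * cuspQ z u 3
   - eps z ^+ 5 * cuspP z u 0 * cuspP z u 1 * cuspP z u 2 * cuspP z u 3 *
     cuspP z u 4
   - cuspQ z u 0 * cuspQ z u 1 * cuspQ z u 2 * cuspQ z u 3 * cuspQ z u 4
   + eps z * cuspP z u 4 * cuspQ z u 0 ^+ 2 * cuspQ z u 2 * cuspQ z u 3
   + eps z * cuspP z u 3 * cuspQ z u 1 * cuspQ z u 2 * cuspQ z u 4 ^+ 2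
   - eps z ^+ 2 * cuspP z u 3 * cuspP z u 4 *
     cuspQ z u 0 * cuspQ z u 2 * cuspQ z u 4)).
  atom_field.
by cusp_ring.
Qed.

Lemma torsY2_opp : torsY2 z u = - torsY1 z u - (1 + b) * torsX z u - b.
Proof.
rewrite bE torsXE torsY1E torsY2E; apply: (@eq_of_factor _ _ (eps z ^+ 4 *
  (cuspP z u 0 * cuspP z u 1 * cuspP z u 2 * cuspP z u 3) /
  (cuspQ z u 0 ^+ 3 * cuspQ z u 1 * cuspQ z u 2 ^+ 2 * cuspQ z u 3 ^+ 2 *
   cuspQ z u 4))
  (eps z ^+ 3 * cuspP z u 1 * cuspP z u 2 * cuspP z u 3 *
     cuspQ z u 2 * cuspQ z u 4
   + eps z ^+ 3 * cuspP z u 0 * cuspP z u 1 * cuspP z u 2 *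
     cuspQ z u 1 * cuspQ z u 3
   - cuspQ z u 0 * cuspQ z u 1 * cuspQ z u 2 * cuspQ z u 3 * cuspQ z u 4
   - eps z ^+ 5 * cuspP z u 0 * cuspP z u 1 * cuspP z u 2 * cuspP z u 3 *
     cuspP z u 4
   + eps z * cuspP z u 4 * cuspQ z u 0 ^+ 2 * cuspQ z u 2 * cuspQ z u 3)).
  atom_field.
by cusp_ring.
Qed.

Lemma tangent_den_tors :
  tangent_den (E5 b) (torsX z u) (torsY1 z u) = torsY1 z u - torsY2 z u.
Proof. by rewrite torsY2_opp /tangent_den /=; ring. Qed.

Lemma tangent_tors : tangent_num (E5 b) (torsX z u) (torsY1 z u) =
  slope z u * tangent_den (E5 b) (torsX z u) (torsY1 z u).
Proof.
rewrite tangent_den_tors bE /tangent_num /slope /= torsXE torsY1E torsY2E.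
apply: (@eq_of_factor _ _ (eps z ^+ 7 *
  (cuspP z u 0 ^+ 2 * cuspP z u 1 ^+ 2 * cuspP z u 2 ^+ 2 * cuspP z u 3) /
  (cuspQ z u 0 ^+ 4 * cuspQ z u 1 * cuspQ z u 2 ^+ 3 * cuspQ z u 3 ^+ 2 *
   cuspQ z u 4 ^+ 2))
  (3%:R * eps z * cuspP z u 3 * cuspQ z u 1 * cuspQ z u 2 * cuspQ z u 4 ^+ 2
   - 2%:R * eps z ^+ 2 * cuspP z u 3 * cuspP z u 4 *
     cuspQ z u 0 * cuspQ z u 2 * cuspQ z u 4
   - cuspQ z u 0 * cuspQ z u 1 * cuspQ z u 2 * cuspQ z u 3 * cuspQ z u 4
   - eps z ^+ 5 * cuspP z u 0 * cuspP z u 1 * cuspP z u 2 * cuspP z u 3 *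
     cuspP z u 4
   - cuspP z u 0 * cuspP z u 1 * slope_factor z u * cuspQ z u 1 * cuspQ z u 3
   + cuspP z u 1 * cuspP z u 3 * slope_factor z u *
     cuspQ z u 2 * cuspQ z u 4)).
  atom_field.
by cusp_ring.
Qed.

Lemma third_tors :
  third (E5 b) (slope z u) (torsX z u) (torsY1 z u) (torsX z u) =
  Affine (dblX z u) (dblY z u).
Proof.
have x3 : third_x (E5 b) (slope z u) (torsX z u) (torsX z u) = dblX z u.
  rewrite bE /third_x /slope /dblX /= torsXE; apply: (@eq_of_factor _ _
    (cuspP z u 0 * cuspP z u 1 /
     (cuspQ z u 0 ^+ 2 * cuspQ z u 1 * cuspQ z u 2 ^+ 2 * cuspQ z u 3 *
      cuspQ z u 4 ^+ 2))
    (cuspP z u 0 * cuspP z u 1 * slope_factor z u ^+ 2 *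
       cuspQ z u 1 * cuspQ z u 3
     + slope_factor z u * cuspQ z u 0 * cuspQ z u 1 * cuspQ z u 2 *
       cuspQ z u 3 * cuspQ z u 4
     + eps z ^+ 5 * cuspP z u 0 * cuspP z u 1 * cuspP z u 2 * cuspP z u 3 *
       cuspP z u 4 * slope_factor z u
     - eps z ^+ 5 * cuspP z u 2 * cuspP z u 3 * cuspP z u 4 *
       cuspQ z u 0 * cuspQ z u 2 * cuspQ z u 4
     + 2%:R * eps z ^+ 4 * cuspP z u 2 * cuspP z u 3 *
       cuspQ z u 1 * cuspQ z u 2 * cuspQ z u 4 ^+ 2
     + eps z ^+ 4 * cuspP z u 2 * cuspP z u 3 *
       cuspQ z u 2 ^+ 2 * cuspQ z u 3 * cuspQ z u 4)).
    atom_field.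
  by cusp_ring.
rewrite /third x3 /=; congr Affine.
rewrite bE /line_y /slope /dblX /dblY torsXE torsY1E.
apply: (@eq_of_factor _ _ (eps z ^+ 4 *
  (cuspP z u 0 * cuspP z u 1 * cuspP z u 2 * cuspP z u 3) /
  (cuspQ z u 0 ^+ 3 * cuspQ z u 1 ^+ 2 * cuspQ z u 2 ^+ 2 * cuspQ z u 3 *
   cuspQ z u 4 ^+ 2))
  (- eps z ^+ 3 * cuspP z u 0 * cuspP z u 1 * cuspP z u 2 *
     cuspQ z u 1 ^+ 2 * cuspQ z u 4
   + cuspP z u 0 * cuspP z u 1 * slope_factor z u *
     cuspQ z u 1 * cuspQ z u 2 * cuspQ z u 3
   - cuspP z u 0 * cuspP z u 1 * slope_factor z u *
     cuspQ z u 1 ^+ 2 * cuspQ z u 4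
   + cuspQ z u 0 * cuspQ z u 1 * cuspQ z u 2 ^+ 2 * cuspQ z u 3 * cuspQ z u 4
   + eps z ^+ 5 * cuspP z u 0 * cuspP z u 1 * cuspP z u 2 * cuspP z u 3 *
     cuspP z u 4 * cuspQ z u 2
   - eps z * cuspP z u 4 *
     cuspQ z u 0 ^+ 2 * cuspQ z u 1 * cuspQ z u 2 * cuspQ z u 4
   - eps z ^+ 3 * cuspP z u 0 * cuspP z u 2 * cuspP z u 3 *
     cuspQ z u 2 * cuspQ z u 3 * cuspQ z u 4)).
  atom_field.
by cusp_ring.
Qed.

(** The substitution permutes these zeros of [b], the indices 0, 1, 2, 3 going to 2, 0, 3, 1, up to
    units. The product type turns the equations into a single rewrite rule. *)
Let P_conj :
  (cuspP (z ^+ 2) u^-1 0 = - z ^+ 2 * eps z ^+ 2 * cuspP z u 2 / u) *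
  (cuspP (z ^+ 2) u^-1 1 = - z ^+ 4 * eps z ^+ 2 * cuspP z u 0 / u) *
  (cuspP (z ^+ 2) u^-1 2 = - z * eps z ^+ 2 * cuspP z u 3 / u) *
  (cuspP (z ^+ 2) u^-1 3 = - z ^+ 3 * eps z ^+ 2 * cuspP z u 1 / u).
Proof. by do !split; cusp_field. Qed.

Let Q_conj :
  (cuspQ (z ^+ 2) u^-1 0 = cuspQ z u 0 / u) *
  (cuspQ (z ^+ 2) u^-1 2 = z ^+ 4 * cuspQ z u 1 / u) *
  (cuspQ (z ^+ 2) u^-1 3 = z * cuspQ z u 4 / u) *
  (cuspQ (z ^+ 2) u^-1 4 = z ^+ 3 * cuspQ z u 2 / u).
Proof. by do !split; cusp_field. Qed.

Let eps_conj : eps (z ^+ 2) = - (eps z)^-1.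
Proof.
have e0 := eps_neq0 hz; apply: (mulIf e0); rewrite mulNr mulVf //; cusp_ring.
Qed.

Lemma torsX_conj : torsX (z ^+ 2) u^-1 = dblX z u.
Proof.
rewrite torsXE !P_conj !Q_conj eps_conj /dblX; field: (prim_expr_order hz).
by rewrite u0 (zeta_neq0 hz) (eps_neq0 hz) !(cuspQ_neq0 _ adm).
Qed.

Lemma torsY1_conj : torsY1 (z ^+ 2) u^-1 = dblY z u.
Proof.
rewrite torsY1E !P_conj !Q_conj eps_conj /dblY; field: (prim_expr_order hz).
by rewrite u0 (zeta_neq0 hz) (eps_neq0 hz) !(cuspQ_neq0 _ adm).
Qed.

(** Inverting z fixes [eps] and reflects the indices: i becomes 3 - i for zeros, because (1 + 1/z)^2
    = (1 + z)^2 / z^2, and -i modulo 5 for poles. *)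
Let P_conj2 :
  (cuspP (z ^+ 4) u 0 = cuspP z u 3) * (cuspP (z ^+ 4) u 1 = cuspP z u 2) *
  (cuspP (z ^+ 4) u 2 = cuspP z u 1) * (cuspP (z ^+ 4) u 3 = cuspP z u 0).
Proof. by do !split; cusp_ring. Qed.

Let Q_conj2 :
  (cuspQ (z ^+ 4) u 0 = cuspQ z u 0) * (cuspQ (z ^+ 4) u 2 = cuspQ z u 3) *
  (cuspQ (z ^+ 4) u 3 = cuspQ z u 2) * (cuspQ (z ^+ 4) u 4 = cuspQ z u 1).
Proof. by do !split; cusp_ring. Qed.

Let eps_conj2 : eps (z ^+ 4) = eps z. Proof. by cusp_ring. Qed.

Lemma torsX_conj2 : torsX (z ^+ 4) u = torsX z u.
Proof. by rewrite !torsXE !P_conj2 !Q_conj2 eps_conj2; atom_field. Qed.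

Lemma torsY1_conj2 : torsY1 (z ^+ 4) u = torsY2 z u.
Proof. by rewrite torsY1E torsY2E !P_conj2 !Q_conj2 eps_conj2; atom_field. Qed.

Let qS k i : z ^+ k * u + z ^+ i != 0.
Proof. exact: (cuspQ_neq0 i (admissible_scale k adm)). Qed.

Let qS0 k : z ^+ k * u + 1 != 0. Proof. exact: (qS k 0). Qed.
Let qS1 k : z ^+ k * u + z != 0. Proof. exact: (qS k 1). Qed.
Let qSz i : z * u + z ^+ i != 0. Proof. exact: (qS 1 i). Qed.
Let qSz0 : z * u + 1 != 0. Proof. exact: (qS 1 0). Qed.
Let qSz1 : z * u + z != 0. Proof. exact: (qS 1 1). Qed.

Ltac scaled_cusp_field :=
  cusp_field; rewrite ?(qS, qS0, qS1, qSz, qSz0, qSz1); try done.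

Lemma torsX_scale_neq k : (0 < k < 5)%N -> torsX z u != torsX z (z ^+ k * u).
Proof.
rewrite -subr_eq0; case: k => [|[|[|[|[|k]]]]] // _.
- have -> : torsX z u - torsX z (z ^+ 1 * u) =
      - z ^+ 3 * eps z ^+ 3 * (1 - z) ^+ 3 * u ^+ 2 *
      (cuspP z u 0 * cuspP z u 1 ^+ 2 * cuspP z u 2) /
      (cuspQ z u 0 ^+ 2 * cuspQ z u 1 * cuspQ z u 2 * cuspQ z u 3 *
       cuspQ z u 4 ^+ 2).
    by rewrite /torsX; scaled_cusp_field.
  cusp_neq0.
- have -> : torsX z u - torsX z (z ^+ 2 * u) =
      eps z ^+ 2 * (1 - z) ^+ 3 * u ^+ 2 *
      (cuspP z u 0 * cuspP z u 1 * cuspP z u 3) /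
      (cuspQ z u 0 ^+ 2 * cuspQ z u 1 * cuspQ z u 2 * cuspQ z u 3 ^+ 2).
    by rewrite /torsX; scaled_cusp_field.
  cusp_neq0.
- have -> : torsX z u - torsX z (z ^+ 3 * u) =
      - z ^+ 2 * eps z ^+ 2 * (1 - z) ^+ 3 * u ^+ 2 *
      (cuspP z u 0 * cuspP z u 2 * cuspP z u 3) /
      (cuspQ z u 0 ^+ 2 * cuspQ z u 2 ^+ 2 * cuspQ z u 3 *
       cuspQ z u 4).
    by rewrite /torsX; scaled_cusp_field.
  cusp_neq0.
- have -> : torsX z u - torsX z (z ^+ 4 * u) =
      z ^+ 4 * eps z ^+ 3 * (1 - z) ^+ 3 * u ^+ 2 *
      (cuspP z u 1 * cuspP z u 2 ^+ 2 * cuspP z u 3) /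
      (cuspQ z u 0 ^+ 2 * cuspQ z u 1 ^+ 2 * cuspQ z u 2 * cuspQ z u 3 *
       cuspQ z u 4).
    by rewrite /torsX; scaled_cusp_field.
  cusp_neq0.
Qed.

(** The case k = 0 says that P and 2P have distinct abscissae, as [has_order5_double] requires; all
    k together separate the two families of five abscissae. *)
Lemma torsX_dblX_neq k : (k < 5)%N -> torsX z u != dblX z (z ^+ k * u).
Proof.
rewrite -subr_eq0; case: k => [|[|[|[|[|k]]]]] // _.
- have -> : torsX z u - dblX z (z ^+ 0 * u) =
      z ^+ 4 * eps z ^+ 3 * (1 - z) ^+ 2 * u *
      (cuspP z u 0 * cuspP z u 1 * cuspP z u 2 * cuspP z u 3) /
      (cuspQ z u 0 ^+ 2 * cuspQ z u 1 * cuspQ z u 2 * cuspQ z u 3 *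
       cuspQ z u 4).
    by rewrite /torsX /dblX; scaled_cusp_field.
  cusp_neq0.
- have -> : torsX z u - dblX z (z ^+ 1 * u) =
      z ^+ 4 * eps z ^+ 3 * (1 - z) ^+ 2 * u *
      (cuspP z u 0 * cuspP z u 1 * cuspP z u 2 ^+ 2) /
      (cuspQ z u 0 ^+ 2 * cuspQ z u 2 * cuspQ z u 3 *
       cuspQ z u 4 ^+ 2).
    by rewrite /torsX /dblX; scaled_cusp_field.
  cusp_neq0.
- have -> : torsX z u - dblX z (z ^+ 2 * u) =
      z ^+ 4 * eps z ^+ 3 * (1 - z) ^+ 2 * u *
      (cuspP z u 0 * cuspP z u 1 ^+ 2 * cuspP z u 3) /
      (cuspQ z u 0 ^+ 2 * cuspQ z u 2 * cuspQ z u 3 ^+ 2 * cuspQ z u 4).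
    by rewrite /torsX /dblX; scaled_cusp_field.
  cusp_neq0.
- have -> : torsX z u - dblX z (z ^+ 3 * u) =
      z ^+ 4 * eps z ^+ 3 * (1 - z) ^+ 2 * u *
      (cuspP z u 0 * cuspP z u 2 ^+ 2 * cuspP z u 3) /
      (cuspQ z u 0 ^+ 2 * cuspQ z u 1 * cuspQ z u 2 ^+ 2 * cuspQ z u 3).
    by rewrite /torsX /dblX; scaled_cusp_field.
  cusp_neq0.
- have -> : torsX z u - dblX z (z ^+ 4 * u) =
      z ^+ 4 * eps z ^+ 3 * (1 - z) ^+ 2 * u *
      (cuspP z u 1 ^+ 2 * cuspP z u 2 * cuspP z u 3) /
      (cuspQ z u 0 ^+ 2 * cuspQ z u 1 ^+ 2 * cuspQ z u 2 * cuspQ z u 3).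
    by rewrite /torsX /dblX; scaled_cusp_field.
  cusp_neq0.
Qed.

End Identities.
End Cusps.

(** * The discriminant and division polynomial of the Tate normal form *)

Section Tate.
Variable K : fieldType.
Implicit Types (z u b x y : K) (P : point K).

Lemma disc_E5 b : disc (E5 b) = - b ^+ 5 * (b ^+ 2 + 11%:R * b - 1).
Proof. by rewrite /disc /=; ring. Qed.

(** At u = 0, [b] would be epsbar^5, a root of the discriminant factor b^2 + 11 b - 1. *)
Lemma admissible_of_smooth z u b : 5.-primitive_root z -> u ^+ 5 + 1 != 0 ->
  b = (eps z ^+ 5 * u ^+ 5 + epsbar z ^+ 5) / (u ^+ 5 + 1) ->
  disc (E5 b) != 0 -> admissible z u b.
Proof.
rewrite disc_E5 => hz u5 hb ds; split=> //.
  apply: contraNneq ds => u0; apply/eqP; have h4 := zeta4 hz.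
  rewrite hb u0 expr0n mulr0 !add0r divr1 /epsbar; ring: h4.
by apply: contraNneq ds => ->; rewrite expr0n oppr0 mul0r.
Qed.

Lemma psi5_poly b : 5%:R != 0 :> K -> exists p : {poly K},
  [/\ p != 0, (size p <= 13)%N & forall x, p.[x] = psi5 (E5 b) x].
Proof.
move=> ne5.
(* The expansion of [psi5 (E5 b)], constant term first; the coefficient 5 of x^12 makes the
   polynomial nonzero. *)
pose s := [:: 0; 5%:R * b ^+ 9; 35%:R * b ^+ 8 + 10%:R * b ^+ 9;
  110%:R * b ^+ 7 + 75%:R * b ^+ 8 + 10%:R * b ^+ 9;
  205%:R * b ^+ 6 + 245%:R * b ^+ 7 + 60%:R * b ^+ 8 + 5%:R * b ^+ 9;
  251%:R * b ^+ 5 + 473%:R * b ^+ 6 + 144%:R * b ^+ 7 + 17%:R * b ^+ 8 + b ^+ 9;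
  210%:R * b ^+ 4 + 615%:R * b ^+ 5 + 165%:R * b ^+ 6 + 15%:R * b ^+ 7;
  120%:R * b ^+ 3 + 570%:R * b ^+ 4 + 90%:R * b ^+ 5;
  45%:R * b ^+ 2 + 375%:R * b ^+ 3 + 45%:R * b ^+ 4;
  10%:R * b + 165%:R * b ^+ 2 + 70%:R * b ^+ 3 + 10%:R * b ^+ 4;
  1 + 43%:R * b + 69%:R * b ^+ 2 + 12%:R * b ^+ 3 + b ^+ 4;
  5%:R + 30%:R * b + 5%:R * b ^+ 2; 5%:R].
exists (Poly s); split; last 1 first.
- move=> x; rewrite horner_Poly /= /psi5 /psi2sq /psi3 /b2 /b4 /b6 /b8 /=; ring.
- by apply: contra_neq ne5 => p0; have := coef_Poly s 12; rewrite p0 coef0.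
- exact: size_Poly.
Qed.

Lemma root_exhaust (p : {poly K}) (rs : seq K) x : p != 0 ->
  (size p <= (size rs).+1)%N -> uniq rs -> all (root p) rs ->
  root p x -> x \in rs.
Proof.
move=> p0 sp urs ars rx; apply/negPn/negP => xrs.
have := @max_poly_roots _ p (x :: rs) p0; rewrite /= rx ars xrs urs.
by move=> /(_ isT isT); rewrite ltnNge sp.
Qed.

(** * The multiples of (0,0) *)

Section Torsion.
Variable b : K.
Hypothesis b0 : b != 0.
Let T : point K := Affine 0 0.

(** The lines through T joining it to T, 2T and 3T have slopes 0, -b and 0; for the chords,
    ordinates are rewritten as values on these lines to fit [add_line]. *)
Lemma muln_origin : [/\ point_muln (E5 b) 1 T = T,
  point_muln (E5 b) 2 T = Affine (- b) (b ^+ 2),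
  point_muln (E5 b) 3 T = Affine (- b) 0,
  point_muln (E5 b) 4 T = Affine 0 (- b) &
  point_muln (E5 b) 5 T = Infinity].
Proof.
have T1 : point_muln (E5 b) 1 T = T by [].
have bN : 0 != - b by rewrite eq_sym oppr_eq0.
have T2 : point_muln (E5 b) 2 T = Affine (- b) (b ^+ 2).
  rewrite /point_muln iterS -/(point_muln _ 1 _) T1 (@add_double _ _ 0).
  - by rewrite /third /third_x /line_y /=; congr Affine; ring.
  - by rewrite /tangent_den /= !mulr0 !add0r.
  - by rewrite /tangent_num /=; ring.
have T3 : point_muln (E5 b) 3 T = Affine (- b) 0.
  rewrite /point_muln iterS -/(point_muln _ 2 _) T2.
  rewrite (_ : b ^+ 2 = line_y (- b) 0 0 (- b)); last by rewrite /line_y; ring.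
  by rewrite add_line // /third /third_x /line_y /=; congr Affine; ring.
have T4 : point_muln (E5 b) 4 T = Affine 0 (- b).
  rewrite /point_muln iterS -/(point_muln _ 3 _) T3.
  rewrite [X in Affine _ X](_ : 0 = line_y 0 0 0 (- b)); last first.
    by rewrite /line_y; ring.
  by rewrite add_line // /third /third_x /line_y /=; congr Affine; ring.
split=> //; rewrite /point_muln iterS -/(point_muln _ 4 _) T4.
rewrite (_ : Affine 0 (- b) = point_opp (E5 b) (Affine 0 0)) ?add_opp //.
by rewrite /=; congr Affine; ring.
Qed.

Lemma has_order_origin : has_order (E5 b) 5 T.
Proof. by case: muln_origin => _ _ _ _ T5; apply: muln5_infinity. Qed.

Lemma in_cyclic_origin x y : on_curve (E5 b) (Affine x y) ->
  in_cyclic (E5 b) T (Affine x y) <-> x = 0 \/ x = - b.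
Proof.
case: muln_origin => T1 T2 T3 T4 T5 hf.
split=> [[m]|].
  (* Natural multiples suffice, since negation preserves the abscissa. *)
  suff mulnx n : point_muln (E5 b) n T = Infinity \/ exists x0 y0,
      point_muln (E5 b) n T = Affine x0 y0 /\ (x0 = 0 \/ x0 = - b).
    rewrite /point_mulz; case: m => n.
      by case: (mulnx n) => [-> //|[x0 [y0 [-> hx]]] [-> _]].
    by case: (mulnx n.+1) => [-> //|[x0 [y0 [-> hx]]] [-> _]].
  have step k : point_muln (E5 b) k.+1 T =
      point_add (E5 b) T (point_muln (E5 b) k T).
    by [].
  have period k : point_muln (E5 b) (k + 5) T = point_muln (E5 b) k T.
    by elim: k => // k IHk; rewrite addSn step IHk.
  have mulE q r : point_muln (E5 b) (q * 5 + r) T = point_muln (E5 b) r T.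
    by elim: q => // q IHq; rewrite mulSn -addnA addnC period IHq.
  rewrite (divn_eq n 5) mulE.
  have := ltn_pmod n (isT : (0 < 5)%N).
  case: (n %% 5)%N => [|[|[|[|[|r]]]]] // _; first by left.
  - by rewrite T1; right; exists 0, 0; split=> //; left.
  - by rewrite T2; right; exists (- b), (b ^+ 2); split=> //; right.
  - by rewrite T3; right; exists (- b), 0; split=> //; right.
  - by rewrite T4; right; exists 0, (- b); split=> //; left.
move: hf => /= + hx; case: hx => -> hf.
  have /eqP : y * (y + b) = 0.
    by transitivity (0 ^+ 3 + b * 0 ^+ 2 + 0 * 0 + 0 : K); [rewrite -hf|]; ring.
  rewrite mulf_eq0 addr_eq0 => /orP[] /eqP ->.
    by exists 1%N.
  by exists 4%N; rewrite /point_mulz T4.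
have /eqP : y * (y - b ^+ 2) = 0.
  by transitivity ((- b) ^+ 3 + b * (- b) ^+ 2 + 0 * - b + 0 : K);
    [rewrite -hf|]; ring.
rewrite mulf_eq0 subr_eq0 => /orP[] /eqP ->.
  by exists 3%N; rewrite /point_mulz T3.
by exists 2%N; rewrite /point_mulz T2.
Qed.
End Torsion.

(** * The points P(z,u) as points of order 5 *)

Definition torsP z u : point K := Affine (torsX z u) (torsY1 z u).

Section Admissible.
Variables z u b : K.
Hypothesis adm : admissible z u b.

Let admC := admissible_conj adm.

Lemma torsP_conj2 : torsP (z ^+ 4) u = Affine (torsX z u) (torsY2 z u).
Proof. by rewrite /torsP (torsX_conj2 adm) (torsY1_conj2 adm). Qed.

(** Brings both ordinates to the form [torsY1], so that facts on [torsP] cover them. *)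
Lemma given_byE P : given_by z u P <-> P = torsP z u \/ P = torsP (z ^+ 4) u.
Proof. by rewrite torsP_conj2. Qed.

Lemma torsP_order : has_order (E5 b) 5 (torsP z u).
Proof.
have dne v w (a : admissible v w b) :
    tangent_den (E5 b) (torsX v w) (torsY1 v w) != 0.
  by rewrite (tangent_den_tors a) (torsY_sub_neq0 a).
have eS := third_tors adm; have eP := third_tors admC.
rewrite -(torsX_conj admC) -(torsY1_conj admC) in eP.
have z22 : (z ^+ 2) ^+ 2 = z ^+ 4 by rewrite -exprM.
rewrite z22 invrK -/(torsP _ _) torsP_conj2 in eP.
rewrite -(torsX_conj adm) -(torsY1_conj adm) in eS.
apply: (has_order5_double (dne _ _ adm) (tangent_tors adm) (dne _ _ admC)
  (tangent_tors admC) _ eS).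
  rewrite (torsX_conj adm).
  by have := torsX_dblX_neq adm (isT : (0 < 5)%N); rewrite mul1r.
by rewrite eP /= (torsY2_opp adm).
Qed.

Lemma torsP_sound :
  [/\ on_curve (E5 b) (torsP z u), has_order (E5 b) 5 (torsP z u)
    & ~ in_cyclic (E5 b) (Affine 0 0) (torsP z u)].
Proof.
have b0 : b != 0 by case: adm.
split; [exact: on_curve_tors adm | exact: torsP_order|].
move/(in_cyclic_origin b0 (on_curve_tors adm)) => [] /eqP; apply/negP.
  exact: torsX_neq0 adm.
by rewrite -addr_eq0 torsXDb_neq0.
Qed.

Lemma psi5_torsX : psi5 (E5 b) (torsX z u) = 0.
Proof. by case: torsP_sound => hc [_ h5 _] _; apply: psi5_root hc h5. Qed.

(** For a fixed abscissa the equation is quadratic in y; one root is [torsY1], and by [torsY2_opp]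
    the sum of the roots makes [torsY2] the other. *)
Lemma on_curve_torsX y : on_curve (E5 b) (Affine (torsX z u) y) ->
  given_by z u (Affine (torsX z u) y).
Proof.
move=> hy; have h1 := on_curve_tors adm; rewrite /= in hy h1.
have /eqP : (y - torsY1 z u) * (y - torsY2 z u) = 0.
  rewrite (torsY2_opp adm).
  rewrite -(subrr (torsX z u ^+ 3 + b * torsX z u ^+ 2 + 0 * torsX z u + 0)).
  by rewrite -{1}hy -h1; ring.
by rewrite mulf_eq0 !subr_eq0 => /orP[] /eqP ->; [left | right].
Qed.
End Admissible.

Lemma given_by_sound z u b P : admissible z u b -> given_by z u P ->
  [/\ on_curve (E5 b) P, has_order (E5 b) 5 P
    & ~ in_cyclic (E5 b) (Affine 0 0) P].
Proof.
move=> adm /(given_byE adm) [] ->; first exact: torsP_sound.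
(* Two conjugations take (z,u) to (z^4,u). *)
apply: torsP_sound; rewrite -[u]invrK (exprM z 2 2).
by do 2!apply: admissible_conj.
Qed.

(** * The twelve roots of the division polynomial *)

Definition torsXs z u : seq K := [seq torsX z (z ^+ i * u) | i <- iota 0 5].

Definition torsXs' z u : seq K :=
  [seq torsX (z ^+ 2) (z ^+ i * u)^-1 | i <- iota 0 5].

Lemma torsX_mod_neq z u b k : admissible z u b -> ~~ (5 %| k)%N ->
  torsX z u != torsX z (z ^+ k * u).
Proof.
move=> adm k5; have hz : 5.-primitive_root z by case: adm.
by rewrite -(prim_expr_mod hz) (torsX_scale_neq adm) // lt0n ltn_mod andbT.
Qed.

Lemma uniq_torsXs z u b : admissible z u b -> uniq (torsXs z u).
Proof.
move=> adm; rewrite map_inj_in_uniq ?iota_uniq // => i j.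
wlog lij : i j / (i < j)%N => [wl|].
  case: (ltngtP i j) => // ij hi hj e; first exact: wl.
  exact/esym/wl.
rewrite !mem_iota /= => _ j5 /eqP e; exfalso; move: e; apply/negP.
have -> : z ^+ j * u = z ^+ (j - i) * (z ^+ i * u).
  by rewrite mulrA -exprD subnK // ltnW.
apply: (torsX_scale_neq (admissible_scale i adm)).
by rewrite subn_gt0 lij /= (leq_ltn_trans (leq_subr _ _)).
Qed.

Lemma uniq_torsXs' z u b : admissible z u b -> uniq (torsXs' z u).
Proof.
move=> adm; have hz : 5.-primitive_root z by case: adm.
rewrite map_inj_in_uniq ?iota_uniq // => i j.
wlog lij : i j / (i < j)%N => [wl|].
  case: (ltngtP i j) => // ij hi hj e; first exact: wl.
  exact/esym/wl.
rewrite !mem_iota /= => _ j5 /eqP e; exfalso; move: e; apply/negP.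
(* The root z^(i-j) is a power of z^2 with exponent 2 (j - i), because 4 = -1 modulo 5. *)
have -> : (z ^+ j * u)^-1 = (z ^+ 2) ^+ (2 * (j - i)) * (z ^+ i * u)^-1.
  have zi : z ^+ i != 0 by rewrite expf_neq0 // zeta_neq0.
  rewrite !invfM mulrA; congr (_ * _); rewrite -exprM.
  apply: (mulIf (expf_neq0 j (zeta_neq0 hz))).
  rewrite mulVf ?expf_neq0 ?zeta_neq0 // mulrAC -exprD.
  apply: (mulIf zi); rewrite mulfVK // mul1r.
  rewrite -(prim_expr_mod hz) -[RHS](prim_expr_mod hz).
  have -> : (2 * (2 * (j - i)) + j = (j - i) * 5 + i)%N.
    by rewrite -[X in (_ + X)%N = _](subnK (ltnW lij)); ring.
  by rewrite modnMDl.
apply: (torsX_mod_neq (admissible_conj (admissible_scale i adm))).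
rewrite Euclid_dvdM // negb_or /= gtnNdvd ?subn_gt0 //.
by rewrite (leq_ltn_trans (leq_subr _ _)).
Qed.

Lemma torsXs_disjoint z u b i j : admissible z u b -> (i < 5)%N ->
  torsX z (z ^+ i * u) != torsX (z ^+ 2) (z ^+ j * u)^-1.
Proof.
move=> adm i5; have hz : 5.-primitive_root z by case: adm.
rewrite (torsX_conj (admissible_scale j adm)).
(* Here [5 - i] stands for -i, and the reduction brings the exponent into the range of
   [torsX_dblX_neq]. *)
have -> : z ^+ j * u = z ^+ ((j + (5 - i)) %% 5) * (z ^+ i * u).
  rewrite (prim_expr_mod hz) mulrA -exprD -addnA subnK 1?ltnW //.
  by rewrite exprD (prim_expr_order hz) mulr1.
by rewrite (torsX_dblX_neq (admissible_scale i adm)) // ltn_mod.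
Qed.

Lemma psi5_roots z u b x : 5%:R != 0 :> K -> admissible z u b ->
  psi5 (E5 b) x = 0 -> x \in [:: 0, - b & torsXs z u ++ torsXs' z u].
Proof.
move=> ne5 adm px; have b0 : b != 0 by case: adm.
have [p [p0 sp hp]] := psi5_poly b ne5.
have admA i := admissible_scale i adm.
have admB i := admissible_conj (admA i).
have notin (f : nat -> K) y : (forall i, f i != y) ->
    y \notin [seq f i | i <- iota 0 5].
  by move=> h; apply/mapP => -[i _ /esym /eqP]; rewrite (negPf (h i)).
have A0 : 0 \notin torsXs z u by apply: notin => i; apply: torsX_neq0 (admA i).
have B0 : 0 \notin torsXs' z u by apply: notin => i; apply: torsX_neq0 (admB i).
have Ab : - b \notin torsXs z u.
  by apply: notin => i; rewrite -addr_eq0 (torsXDb_neq0 (admA i)).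
have Bb : - b \notin torsXs' z u.
  by apply: notin => i; rewrite -addr_eq0 (torsXDb_neq0 (admB i)).
have disj : ~~ has (mem (torsXs z u)) (torsXs' z u).
  apply/hasPn => _ /mapP[j _ ->]; apply/mapP => -[i].
  rewrite mem_iota => /= i5 /esym /eqP.
  by rewrite (negPf (torsXs_disjoint j adm i5)).
(* The list has 2 + 5 + 5 = 12 entries, which matches [size p <= 13]. *)
apply: (@root_exhaust p) => //; last by rewrite /root hp px.
  rewrite 2!cons_uniq cat_uniq in_cons 2!mem_cat 3!negb_or eq_sym oppr_eq0 b0.
  by rewrite A0 B0 Ab Bb disj (uniq_torsXs adm) (uniq_torsXs' adm).
apply/allP => r; rewrite 2!in_cons mem_cat /root hp.
case/or4P => [/eqP->|/eqP->|/mapP[i _ ->]|/mapP[i _ ->]].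
- by apply/eqP; rewrite /psi5 /psi2sq /psi3 /b2 /b4 /b6 /b8 /=; ring.
- by apply/eqP; rewrite /psi5 /psi2sq /psi3 /b2 /b4 /b6 /b8 /=; ring.
- by rewrite (psi5_torsX (admA i)).
- by rewrite (psi5_torsX (admB i)).
Qed.
End Tate.

Theorem theorem2p1 (K : fieldType) (char_neq5 : 5%:R != 0 :> K)
    (zeta u b : K) (zeta_prim : 5.-primitive_root zeta)
    (u_dom : u ^+ 5 + 1 != 0)
    (b_def : b = (eps zeta ^+ 5 * u ^+ 5 + epsbar zeta ^+ 5) / (u ^+ 5 + 1))
    (E5_smooth : disc (E5 b) != 0) :
  [/\ on_curve (E5 b) (Affine 0 0),
      has_order (E5 b) 5 (Affine 0 0) &
      forall P : point K,
        [/\ on_curve (E5 b) P, has_order (E5 b) 5 P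
          & ~ in_cyclic (E5 b) (Affine 0 0) P] <->
        exists i : 'I_5,
          given_by zeta (zeta ^+ i * u) P \/
          given_by (zeta ^+ 2) (zeta ^+ i * u)^-1 P].
Proof.
have adm := admissible_of_smooth zeta_prim u_dom b_def E5_smooth.
have b0 : b != 0 by case: adm.
split; [by rewrite /=; ring | exact: has_order_origin|].
case=> [|x y]; split.
(* [Infinity] is killed already by 1, so its order is not 5. *)
- by case=> _ [_ _ /(_ 1%N isT)].
- by case=> i [] [].
- case=> hc [_ h5 _] hcyc.
  have := psi5_roots char_neq5 adm (psi5_root hc h5).
  rewrite 2!in_cons mem_cat => /or4P[/eqP x0|/eqP xb|/mapP[i]|/mapP[i]].
  + by case: hcyc; apply/in_cyclic_origin => //; left.
  + by case: hcyc; apply/in_cyclic_origin => //; right.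
  + rewrite mem_iota => /= i5 ex; exists (Ordinal i5); left.
    by rewrite ex in hc *; apply: on_curve_torsX (admissible_scale i adm) _ hc.
  rewrite mem_iota => /= i5 ex; exists (Ordinal i5); right.
  rewrite ex in hc *.
  exact: on_curve_torsX (admissible_conj (admissible_scale i adm)) _ hc.
case=> i [] hP; first exact: given_by_sound (admissible_scale i adm) hP.
exact: given_by_sound (admissible_conj (admissible_scale i adm)) hP.
Qed.
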